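(* Let $p\in[2,\infty)$ and assume the following. (Initial value) $\xi:\Omega\to H$ is $\mathcal F_0/\mathcal B(H)$-measurable and $p$-fold integrable. (Linear stability) $S_k:H\to H$, $k\in(0,T]$, is a family of bounded linear operators and there is a constant $C_S$ independent of $k$ with $\sup_{k\in(0,T]}\sup_{n\in\{1,\dots,N_k\}}\|S_k^n\|_{\mathcal L(H)}\le C_S$. (Nonlinear stability) $\Phi:H\times\mathbb T\times\Omega\to H$ is such that for every $(t,k)\in\mathbb T$ the mapping $(x,\omega)\mapsto\Phi(x,t,k)(\omega)$ is $\mathcal B(H)\otimes\mathcal F_{t+k}/\mathcal B(H)$-measurable, and there is a constant $C_\Phi$ such that $$\Big\|\sum_{j=m}^nS_k^{n-j}\Phi(0,t_{j-1},k)\Big\|_{L_p(\Omega;H)}\le C_\Phi(t_n-t_{m-1})^{1/2}$$ for all $k\in(0,T]$ and $n,m\in\{1,\dots,N_k\}$ with $n\ge m$, and $$\Big\|\sum_{j=1}^nS_k^{n-j}\big(\Phi(Y(t_{j-1}),t_{j-1},k)-\Phi(Z(t_{j-1}),t_{j-1},k)\big)\Big\|_{L_p(\Omega;H)}^2\le C_\Phi^2k\sum_{j=1}^n(t_n-t_{j-1})^{-1/2}\|Y(t_{j-1})-Z(t_{j-1})\|_{L_p(\Omega;H)}^2$$ for all $k\in(0,T]$, $n\in\{1,\dots,N_k\}$ and $Y,Z\in\mathcal G_p(\mathcal T_k)$. Then the residual operators $\mathcal R_k:\mathcal G_p(\mathcal T_k)\to\mathcal G_p(\mathcal T_k)$ are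 well-defined and bijective for all $k\in(0,T]$, and the one-step scheme given by $(\xi,S_k,\Phi)$ is bistable, i.e. there is a constant $C_{\mathrm{Stab}}$ independent of $k\in(0,T]$ such that $$\frac1{C_{\mathrm{Stab}}}\|\mathcal R_k[Y]-\mathcal R_k[Z]\|_{-1,p}\le\|Y-Z\|_{0,p}\le C_{\mathrm{Stab}}\|\mathcal R_k[Y]-\mathcal R_k[Z]\|_{-1,p}$$ for all $k\in(0,T]$ and $Y,Z\in\mathcal G_p(\mathcal T_k)$.
   Context: Let $T\in(0,\infty)$, $H$ a separable real Hilbert space, $(\Omega,\mathcal F,\mathbf P)$ a probability space with a normal filtration $(\mathcal F_t)_{t\in[0,T]}$ satisfying the usual conditions, $\|Z\|_{L_p(\Omega;H)}=(\mathbb E\|Z\|^p)^{1/p}$. For $k\in(0,T]$, $N_k\in\mathbb N$ satisfies $N_kk\le T<(N_k+1)k$, $t_n=nk$, $\mathcal T_k=\{t_0,\dots,t_{N_k}\}$. $\mathbb T=\{(t,k)\in[0,T)\times(0,T]:t+k\le T\}$. The one-step scheme is $X_k(t_0)=\xi$, $X_k(t_n)=S_kX_k(t_{n-1})+\Phi(X_k(t_{n-1}),t_{n-1},k)$, $n=1,\dots,N_k$. $\mathcal G_p(\mathcal T_k)$ is the space of $Z:\mathcal T_k\times\Omega\to H$ with $Z(t_n)\in L_p(\Omega,\mathcal F_{t_n},\mathbf P;H)$ for all $n\in\{0,\dots,N_k\}$. Residual operator: $\mathcal R_k[Z](t_0)=Z(t_0)-\xi$, $\mathcal R_k[Z](t_n)=Z(t_n)-S_kZ(t_{n-1})-\Phi(Z(t_{n-1}),t_{n-1},k)$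 for $n\ge1$. Norms: $\|Z\|_{0,p}=\max_{0\le n\le N_k}\|Z(t_n)\|_{L_p(\Omega;H)}$ and (stochastic Spijker norm) $\|Z\|_{-1,p}=\|Z(t_0)\|_{L_p(\Omega;H)}+\max_{1\le n\le N_k}\|\sum_{j=1}^nS_k^{n-j}Z(t_j)\|_{L_p(\Omega;H)}$, with $S_k^0=\mathrm{Id}_H$. *)

(* Defs.v *)
From HB Require Import structures.
From mathcomp Require Import all_boot all_order all_algebra.
From mathcomp Require Import all_classical all_reals all_analysis.

Set Implicit Arguments.
Unset Strict Implicit.
Unset Printing Implicit Defensive.

Import Order.TTheory GRing.Theory Num.Theory.
Import numFieldNormedType.Exports.

Local Open Scope classical_set_scope.
Local Open Scope ring_scope.

Definition separable (X : topologicalType) : Prop :=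
  exists A : set X, countable A /\ dense A.

(* Completeness is carried by the type of H; an inner product inducing the norm
   makes it a Hilbert space. *)
Definition hilbert (R : realType) (H : completeNormedModType R) : Prop :=
  exists dot : {dot H for idfun}, forall x : H, `|x| ^+ 2 = dot x x.

Definition borel (X : topologicalType) : set_system X := <<s @open X >>.

Definition prod_sigma (X Y : Type) (G : set_system X) (K : set_system Y) :
    set_system (X * Y) :=
  <<s [set A `*` B | A in G & B in K] >>.

(* The library's measurable_fun reads both sigma-algebras off the types, which
   does not suit the several sigma-algebras of a filtration on one space. *)
Definition measurable_wrt (X Y : Type) (G : set_system X) (K : set_system Y)
    (f : X -> Y) : Prop :=
  forall B, K B -> G (f @^-1` B).

Record normal_filtration (R : realType) (d : measure_display)
    (Omega : measurableType d) (P : probability Omega R) (T : R)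
    (F : R -> set_system Omega) : Prop := NormalFiltration {
  filtration_sigma_algebra :
    forall t : R, 0 <= t <= T -> sigma_algebra setT (F t);
  filtration_sub : forall t : R, 0 <= t <= T -> F t `<=` measurable;
  filtration_mono : forall s t : R, 0 <= s -> s <= t -> t <= T -> F s `<=` F t;
  filtration_null : forall A, measurable A -> P A = 0%E -> F 0 A;
  filtration_right_continuous :
    forall t : R, 0 <= t < T -> F t = \bigcap_(s in [set s | t < s <= T]) F s
}.

Definition grid (R : realType) (k : R) (n : nat) : R := n%:R * k.

(* Extended-real valued: +oo unless f is bounded. *)
Definition opnorm (R : realType) (H : normedModType R) (f : H -> H) : \bar R :=
  ereal_sup [set `|f x|%:E | x in [set x : H | `|x| <= 1]].

(* Extended-real valued: +oo when E |Z|^p is infinite. *)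
Definition Lpnorm (R : realType) (d : measure_display)
    (Omega : measurableType d) (P : probability Omega R)
    (H : normedModType R) (p : R) (Z : Omega -> H) : \bar R :=
  Lnorm P p%:E (fun w => `|Z w|%:E).

Section OneStep.
Variables (R : realType) (d : measure_display) (Omega : measurableType d).
Variables (P : probability Omega R) (H : completeNormedModType R).
Variables (T p : R) (F : R -> set_system Omega).
Variable N : R -> nat.
Variables (xi : Omega -> H) (S : R -> {linear H -> H}).
Variable Phi : H -> R -> R -> Omega -> H.

Definition Lpspace (G : set_system Omega) (Z : Omega -> H) : Prop :=
  measurable_wrt G (@borel H) Z /\ (Lpnorm P p Z < +oo)%E.

(* A process on {t_0, ..., t_(N k)} is indexed by n, Z n standing for Z(t_n).
   Everything below (membership, equality, norms, residual) only looks at the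
   indices n <= N k, so the remaining values of Z are immaterial. *)
Definition gridprocess := nat -> Omega -> H.

Definition subprocess (Y Z : gridprocess) : gridprocess :=
  fun n w => Y n w - Z n w.

Definition Gp (k : R) : set gridprocess :=
  [set Z | forall n, (n <= N k)%N -> Lpspace (F (grid k n)) (Z n)].

(* Equality in the space of processes: the Z(t_n) are elements of L_p, that is,
   classes modulo almost sure equality. *)
Definition Gp_eq (k : R) (Y Z : gridprocess) : Prop :=
  forall n, (n <= N k)%N -> Y n = Z n %[ae P].

Definition norm0 (k : R) (Z : gridprocess) : \bar R :=
  \big[maxe/0%E]_(0 <= n < (N k).+1) Lpnorm P p (Z n).

Definition spijker_norm (k : R) (Z : gridprocess) : \bar R :=
  (Lpnorm P p (Z 0%N) +
   \big[maxe/0]_(1 <= n < (N k).+1)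
     Lpnorm P p (fun w => \sum_(1 <= j < n.+1) iter (n - j) (S k) (Z j w))%R)%E.

Definition residual (k : R) (Z : gridprocess) : gridprocess := fun n w =>
  if n is m.+1 then Z m.+1 w - S k (Z m w) - Phi (Z m w) (grid k m) k w
  else Z 0%N w - xi w.

Definition initial_value : Prop := Lpspace (F 0) xi.

Definition linear_stability : Prop :=
  (forall k : R, 0 < k <= T -> (opnorm (S k) < +oo)%E) /\
  exists C_S : R, forall k : R, 0 < k <= T ->
    forall n, (1 <= n <= N k)%N -> (opnorm (iter n (S k)) <= C_S%:E)%E.

(* Phi is only constrained, and only used, on the times (t, k) with 0 <= t < T,
   0 < k <= T and t + k <= T. *)
Definition Phi_measurable : Prop :=
  forall t k : R, 0 <= t < T -> 0 < k <= T -> t + k <= T ->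
    measurable_wrt (prod_sigma (@borel H) (F (t + k))) (@borel H)
      (fun z : H * Omega => Phi z.1 t k z.2).

Definition Phi_at_zero_bound (C_Phi : R) : Prop :=
  forall k : R, 0 < k <= T -> forall m n, (1 <= m)%N -> (m <= n)%N -> (n <= N k)%N ->
    (Lpnorm P p (fun w =>
       \sum_(m <= j < n.+1) iter (n - j) (S k) (Phi 0 (grid k j.-1) k w))%R
     <= (C_Phi * (grid k n - grid k m.-1) `^ (1 / 2))%:E)%E.

Definition Phi_lipschitz_bound (C_Phi : R) : Prop :=
  forall k : R, 0 < k <= T -> forall n, (1 <= n <= N k)%N ->
  forall Y Z, Gp k Y -> Gp k Z ->
    ((Lpnorm P p (fun w =>
        \sum_(1 <= j < n.+1) iter (n - j) (S k)
          (Phi (Y j.-1 w) (grid k j.-1) k w -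
           Phi (Z j.-1 w) (grid k j.-1) k w))%R) ^+ 2
     <= (C_Phi ^+ 2 * k)%:E *
        \sum_(1 <= j < n.+1)
          ((grid k n - grid k j.-1) `^ (- (1 / 2)))%:E *
          Lpnorm P p (subprocess Y Z j.-1) ^+ 2)%E.

Definition nonlinear_stability : Prop :=
  Phi_measurable /\
  exists C_Phi : R, Phi_at_zero_bound C_Phi /\ Phi_lipschitz_bound C_Phi.

Definition residual_well_defined (k : R) : Prop :=
  (forall Z, Gp k Z -> Gp k (residual k Z)) /\
  (forall Y Z, Gp k Y -> Gp k Z -> Gp_eq k Y Z ->
     Gp_eq k (residual k Y) (residual k Z)).

Definition residual_bijective (k : R) : Prop :=
  (forall Y Z, Gp k Y -> Gp k Z ->
     Gp_eq k (residual k Y) (residual k Z) -> Gp_eq k Y Z) /\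
  (forall V, Gp k V -> exists2 Z, Gp k Z & Gp_eq k (residual k Z) V).

Definition bistable : Prop :=
  exists C_Stab : R, 0 < C_Stab /\
    forall k : R, 0 < k <= T -> forall Y Z, Gp k Y -> Gp k Z ->
      let RYZ := subprocess (residual k Y) (residual k Z) in
      ((C_Stab^-1)%:E * spijker_norm k RYZ <= norm0 k (subprocess Y Z))%E /\
      (norm0 k (subprocess Y Z) <= C_Stab%:E * spijker_norm k RYZ)%E.

End OneStep.

(* Main.v *)
Require Import Defs.
From HB Require Import structures.
From mathcomp Require Import all_boot all_order all_algebra.
From mathcomp Require Import all_classical all_reals all_analysis.
From mathcomp Require Import measurable_realfun ring lra.

Set Implicit Arguments.
Unset Strict Implicit.
Unset Printing Implicit Defensive.

Import Order.TTheory GRing.Theory Num.Theory.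
Import numFieldNormedType.Exports.

Local Open Scope classical_set_scope.
Local Open Scope ring_scope.

(** The residual operator is inverted by running the scheme itself: Z(t_n) is
    determined by Z(t_(n-1)) and the prescribed residual at t_n.  Hence the
    bijectivity of the residual operator on adapted L_p processes comes down
    to one fact, [Phi_Lpspace]: a single step maps L_p over F(t_m) into L_p
    over F(t_(m+1)).  Adaptedness is the joint measurability of Phi.  For the
    integrability, the Lipschitz hypothesis is only available in summed form,
    but tested against a process that vanishes off one grid point and against
    the zero process, its sum collapses to the one term Phi(Z) - Phi(0), and
    Phi(0) is controlled by the other hypothesis on Phi.

    Bistability rests on a discrete variation of constants formula,
    [residual_conv].  Write e_n = Y(t_n) - Z(t_n), and let r_j and phi_j be the
    differences of the residuals and of the increments of Phi at step j; then
<<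
      sum_(1 <= j <= n) S^(n-j) r_j
        = e_n - (S^n e_0 + sum_(1 <= j <= n) S^(n-j) phi_j).
>>
    The left-hand side is what the Spijker norm measures, S^n is bounded, and
    the last sum is bounded by the Lipschitz hypothesis through the weakly
    singular kernel (t_n - t_(j-1))^(-1/2).  The Minkowski inequality in one
    direction, with the uniform bound [singular_kernel_sum_le] on the sums of
    the kernel, bounds the Spijker norm by the maximum norm
    ([residual_conv_bound]).  In the other direction it bounds the squared L_p
    norm of e_n by the square of the Spijker norm plus a kernel sum of the
    earlier squared errors, and a Gronwall inequality for this kernel,
    [singular_gronwall], concludes ([error_bound]).  Its constant depends on T and on the size of the kernel
    but not on the step size k, which is the point of the theorem.

    The separability of H makes sums of H-valued random variables measurable
    ([measurable_wrtD]). *)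

(** * Borel measurability with respect to a given sigma-algebra *)

Section BorelMeasurability.

Lemma sigma_algebra_setI (X : pointedType) (G : set_system X) (A B : set X) :
  sigma_algebra setT G -> G A -> G B -> G (A `&` B).
Proof.
by move=> sG; rewrite -(measurable_g_measurableTypeE sG); exact: measurableI.
Qed.

Lemma measurable_wrt_generated (X Y : Type) (G : set_system X)
    (K : set_system Y) (f : X -> Y) :
  sigma_algebra setT G -> (forall B, K B -> G (f @^-1` B)) ->
  measurable_wrt G <<s K >> f.
Proof.
move=> sG Kf B KB; have := sigma_algebra_image f sG.
rewrite /image_set_system => sI; rewrite -[f @^-1` B]setTI.
apply: (smallest_sub sI) KB => A KA /=; rewrite setTI; exact: Kf.
Qed.

Lemma measurable_wrtS (X Y : Type) (G G' : set_system X) (K : set_system Y)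
    (f : X -> Y) : G `<=` G' -> measurable_wrt G K f -> measurable_wrt G' K f.
Proof. by move=> GG' mf B /mf; exact: GG'. Qed.

Lemma measurable_wrt_cst (X Y : Type) (G : set_system X) (K : set_system Y)
  (y : Y) : sigma_algebra setT G -> measurable_wrt G K (fun=> y).
Proof.
move=> [G0 GC _] B _; have GT : G setT by rewrite -[setT]setD0; exact: GC.
have [By|By] := pselect (B y).
- by rewrite (_ : _ @^-1` B = setT)//; apply/seteqP; split.
- by rewrite (_ : _ @^-1` B = set0)//; apply/seteqP; split.
Qed.

Lemma measurable_wrt_continuous (X : Type) (Y Z : topologicalType)
    (G : set_system X) (f : X -> Y) (g : Y -> Z) :
  sigma_algebra setT G -> continuous g -> measurable_wrt G (@borel Y) f ->
  measurable_wrt G (@borel Z) (fun x => g (f x)).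
Proof.
move=> sG cg mf; apply: measurable_wrt_generated => // B oB.
rewrite -[X in G X]/(f @^-1` (g @^-1` B)); apply: mf.
by apply: sub_sigma_algebra; apply: open_comp => // x _; exact: cg.
Qed.

Lemma measurable_wrt_pair (X : pointedType) (Y Z : Type) (G : set_system X)
    (K : set_system Y) (L : set_system Z) (f : X -> Y) (g : X -> Z) :
  sigma_algebra setT G -> measurable_wrt G K f -> measurable_wrt G L g ->
  measurable_wrt G (prod_sigma K L) (fun x => (f x, g x)).
Proof.
move=> sG mf mg; apply: measurable_wrt_generated => // _ [A KA [B LB <-]].
rewrite (_ : _ @^-1` _ = f @^-1` A `&` g @^-1` B)//.
by apply: sigma_algebra_setI => //; [exact: mf|exact: mg].
Qed.

Lemma separable_dense_sequence (X : ptopologicalType) : separable X ->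
  exists e : nat -> X, forall O, open O -> O !=set0 -> exists n, O (e n).
Proof.
move=> [A [/pcard_geP/unsquash e dA]]; exists e => O oO O0.
have [x [Ox /(@surj _ _ _ _ e)[n _ enx]]] := dA O O0 oO.
by exists n; rewrite enx.
Qed.

(** In general the Borel sigma-algebra of H x H is larger than the product of
    the Borel sigma-algebras, so the continuity of the addition is not enough.
    A dense sequence provides what is missing: f + g takes its value in an open
    U exactly when f and g are close to two points of the sequence around whose
    sum U contains a ball, which is a countable union of measurable conditions. *)
Lemma measurable_wrtD (R : realType) (H : normedModType R) (X : pointedType)
    (G : set_system X) (f g : X -> H) :
  separable H -> sigma_algebra setT G ->
  measurable_wrt G (@borel H) f -> measurable_wrt G (@borel H) g ->
  measurable_wrt G (@borel H) (fun x => f x + g x).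
Proof.
move=> /(@separable_dense_sequence H)[e de] sG mf mg.
apply: measurable_wrt_generated => // U oU.
pose r n : R := n.+1%:R^-1.
have rgt0 n : 0 < r n by rewrite invr_gt0.
pose E i j n := [set x | ball (e i + e j) (r n + r n) `<=` U] `&`
  (f @^-1` ball (e i) (r n) `&` g @^-1` ball (e j) (r n)).
have GE i j n : G (E i j n).
  rewrite /E; have [h|h] := pselect (ball (e i + e j) (r n + r n) `<=` U).
    rewrite (_ : [set x | _] = setT) ?setTI; last by apply/seteqP; split.
    by apply: sigma_algebra_setI => //; [apply: mf|apply: mg];
      apply: sub_sigma_algebra; exact: ball_open.
  rewrite (_ : [set x | _] = set0) ?set0I; first by case: sG.
  by apply/seteqP; split.
rewrite (_ : _ @^-1` U = \bigcup_i \bigcup_j \bigcup_n E i j n).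
  by case: sG => _ _ GU; apply: (GU) => i; apply: (GU) => j; apply: (GU).
apply/seteqP; split => [x /= Ux|x [i _ [j _ [n _ [/= sU [fx gx]]]]]]; last first.
  apply: sU; move: fx gx; rewrite -!ball_normE /= => fx gx.
  rewrite opprD addrACA; apply: le_lt_trans (ler_normD _ _) _.
  exact: ltrD.
have /nbhs_ballP[/= s s0 sU] : nbhs (f x + g x) U by exact: open_nbhs_nbhs.
(* Two approximations and the ball around their sum cost 4 r n in total. *)
have [n rn] : exists n, r n < s / 4.
  have s4 : 0 < s / 4 by rewrite divr_gt0.
  have /archi_boundP h : 0 <= (s / 4)^-1 by rewrite invr_ge0 ltW.
  exists (Num.bound (s / 4)^-1).
  rewrite /r -[ltRHS]invrK ltf_pV2 ?posrE ?invr_gt0//.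
  by apply: (lt_trans h); rewrite ltr_nat.
have [i /= fi] : exists i, ball (f x) (r n) (e i).
  by apply: de; [exact: ball_open|exists (f x); exact: ballxx].
have [j /= gj] : exists j, ball (g x) (r n) (e j).
  by apply: de; [exact: ball_open|exists (g x); exact: ballxx].
exists i => //; exists j => //; exists n => //; split => /=; last first.
  by split; exact: ball_sym.
move=> z; rewrite -ball_normE /= => ez; apply: sU.
move: fi gj; rewrite -!ball_normE /= => fi gj.
rewrite (_ : _ - z = (f x - e i) + (g x - e j) + (e i + e j - z)); last first.
  by rewrite [X in X + (_ - z)]addrACA -opprD addrA subrK.
apply: le_lt_trans (ler_normD _ _) _.
apply: (@lt_trans _ _ (r n + r n + (r n + r n))); last by lra.
rewrite ltrD//; apply: le_lt_trans (ler_normD _ _) _; exact: ltrD.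
Qed.

(** The bridge from H-valued measurability to the integration theory of
    real-valued functions. *)
Lemma measurable_wrt_norm (R : realType) (H : normedModType R)
    (d : measure_display) (X : measurableType d) (f : X -> H) :
  measurable_wrt measurable (@borel H) f ->
  measurable_fun setT (fun x => `|f x|).
Proof.
move=> mf; apply: (measurability _ (RGenOpens.measurableE R)).
move=> _ [_ [a [b ->]] <-]; rewrite setTI.
have : measurable_wrt measurable (@borel R) (fun x => `|f x|).
  apply: measurable_wrt_continuous mf; first exact: sigma_algebra_measurable.
  exact: norm_continuous.
apply; apply: sub_sigma_algebra; exact: interval_open.
Qed.

End BorelMeasurability.

(** * Random variables with a finite p-th moment *)

Section LpSpaces.
Context (R : realType) (d : measure_display) (Omega : measurableType d).
Context (P : probability Omega R) (H : completeNormedModType R) (p : R).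
Hypothesis H_sep : separable H.
Hypothesis p_ge1 : 1 <= p.
Implicit Types (Z W : Omega -> H) (G : set_system Omega).

Definition lp Z : R := fine (Lpnorm P p Z).

Lemma lp_ge0 Z : 0 <= lp Z.
Proof. by rewrite fine_ge0// Lnorm_ge0. Qed.

Lemma LpnormE Z : (Lpnorm P p Z < +oo)%E -> Lpnorm P p Z = (lp Z)%:E.
Proof. by move=> Zoo; rewrite fineK// ge0_fin_numE// Lnorm_ge0. Qed.

Lemma Lnorm_le (f g : Omega -> R) :
  measurable_fun setT f -> measurable_fun setT g ->
  (forall w, 0 <= f w <= g w) ->
  (Lnorm P p%:E (EFin \o f) <= Lnorm P p%:E (EFin \o g))%E.
Proof.
move=> mf mg fg; have p0 : 0 <= p by apply: le_trans p_ge1.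
have mpow (h : Omega -> R) : measurable_fun setT h ->
    measurable_fun setT ((fun x => `|(h x)%:E| `^ p)%E : Omega -> \bar R).
  move=> mh; apply: (measurableT_comp (measurable_poweR _)).
  by apply: measurableT_comp => //; exact/measurable_EFinP.
rewrite unlock /Lnorm; apply: gt0_ler_poweR; rewrite ?invr_ge0//.
- by rewrite in_itv /= leey andbT; apply: integral_ge0 => x _; rewrite lee_fin powR_ge0.
- by rewrite in_itv /= leey andbT; apply: integral_ge0 => x _; rewrite lee_fin powR_ge0.
apply: ge0_le_integral => //; [by move=> *; exact: poweR_ge0|exact: mpow|exact: mpow|].
move=> x _; have /andP[f0 fgx] := fg x.
by apply: gt0_ler_poweR;
  rewrite ?in_itv /= ?leey ?lee_fin ?normr_ge0// !ger0_norm// (le_trans f0).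
Qed.

(** A pointwise Lipschitz bound passes to the L_p norm; C = 1 is monotonicity,
    and the norm of a bounded operator gives the general case. *)
Lemma Lpnorm_le Z W (C : R) :
  measurable_wrt measurable (@borel H) W -> Lpspace P p measurable Z ->
  0 <= C -> (forall w, `|W w| <= C * `|Z w|) ->
  (Lpnorm P p W <= C%:E * Lpnorm P p Z)%E.
Proof.
move=> mW [mZ Zoo] C0 WZ.
have p1 : (1%:E <= p%:E)%E by rewrite lee_fin.
have LZ : (fun w => `|Z w|) \in Lfun P p%:E.
  rewrite inE; apply/andP; split; rewrite inE/=.
    exact: measurable_wrt_norm.
  exact: Zoo.
have := @LnormZ _ _ _ P p%:E p1 (Lfun_Sub p1 LZ) C.
rewrite ger0_norm// => <-.
apply: Lnorm_le.
- exact: measurable_wrt_norm.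
- by apply: measurable_funM => //; exact: measurable_wrt_norm.
- by move=> w; rewrite normr_ge0 WZ.
Qed.

Lemma Lpnorm_add Z W :
  measurable_wrt measurable (@borel H) Z ->
  measurable_wrt measurable (@borel H) W ->
  (Lpnorm P p (fun w => (Z w + W w)%R) <= Lpnorm P p Z + Lpnorm P p W)%E.
Proof.
move=> mZ mW.
have nZ := measurable_wrt_norm mZ; have nW := measurable_wrt_norm mW.
apply: le_trans (minkowski_EFin P nZ nW p_ge1).
apply: Lnorm_le.
- apply: measurable_wrt_norm; apply: measurable_wrtD => //.
  exact: sigma_algebra_measurable.
- exact: measurable_funD.
- by move=> w; rewrite normr_ge0 ler_normD.
Qed.

Lemma sub_Lpspace G G' Z : G `<=` G' -> Lpspace P p G Z -> Lpspace P p G' Z.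
Proof. by move=> GG' [mZ Zoo]; split => //; exact: measurable_wrtS mZ. Qed.

Section SubSigmaAlgebra.
Variable G : set_system Omega.
Hypotheses (sG : sigma_algebra setT G) (Gm : G `<=` measurable).
Local Notation Lp := (@Lpspace R d Omega P H p G).

Lemma Lpspace0 : Lp (fun=> 0).
Proof.
split; first exact: measurable_wrt_cst.
rewrite /Lpnorm (@eq_Lnorm _ _ _ _ _ _ (cst 0%E)) ?Lnorm0//.
  by rewrite eqe gt_eqF// (lt_le_trans _ p_ge1).
by move=> w; rewrite /= normr0.
Qed.

Lemma Lpspace_add Z W : Lp Z -> Lp W -> Lp (fun w => Z w + W w).
Proof.
move=> [mZ Zoo] [mW Woo]; split; first exact: measurable_wrtD.
apply: le_lt_trans (Lpnorm_add _ _) _; rewrite ?lte_add_pinfty//.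
  exact: measurable_wrtS mZ.
exact: measurable_wrtS mW.
Qed.

Lemma Lpspace_lipschitz (f : H -> H) (C : R) Z : continuous f -> 0 <= C ->
  (forall x, `|f x| <= C * `|x|) -> Lp Z -> Lp (fun w => f (Z w)).
Proof.
move=> cf C0 fC LZ; have [mZ Zoo] := LZ.
have mfZ : measurable_wrt G (@borel H) (fun w => f (Z w)).
  exact: measurable_wrt_continuous mZ.
split => //; apply: (@le_lt_trans _ _ (C%:E * Lpnorm P p Z)%E).
  apply: Lpnorm_le => //; first exact: measurable_wrtS mfZ.
  exact: sub_Lpspace LZ.
by rewrite LpnormE// -EFinM ltry.
Qed.

Lemma Lpspace_opp Z : Lp Z -> Lp (fun w => - Z w).
Proof.
apply: (@Lpspace_lipschitz -%R 1) => //; first exact: opp_continuous.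
by move=> x; rewrite normrN mul1r.
Qed.

Lemma Lpspace_sub Z W : Lp Z -> Lp W -> Lp (fun w => Z w - W w).
Proof. by move=> LZ LW; apply: Lpspace_add => //; exact: Lpspace_opp. Qed.

Lemma Lpspace_sum (I : eqType) (s : seq I) (Z : I -> Omega -> H) :
  (forall i, i \in s -> Lp (Z i)) -> Lp (fun w => \sum_(i <- s) Z i w).
Proof.
elim: s => [|i s IHs] LZ.
  by under eq_fun do rewrite big_nil; exact: Lpspace0.
under eq_fun do rewrite big_cons; apply: Lpspace_add.
  by apply: LZ; rewrite mem_head.
by apply: IHs => j js; apply: LZ; rewrite in_cons js orbT.
Qed.

End SubSigmaAlgebra.

Local Notation Lp := (@Lpspace R d Omega P H p measurable).

Lemma lpD Z W : Lp Z -> Lp W -> lp (fun w => Z w + W w) <= lp Z + lp W.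
Proof.
move=> LZ LW; have [_ ZWoo] := Lpspace_add (@sigma_algebra_measurable _ _) (fun _ h => h) LZ LW.
case: LZ LW => mZ Zoo [mW Woo].
by rewrite -lee_fin EFinD -!LpnormE//; exact: Lpnorm_add.
Qed.

Lemma lp_le Z W (C : R) : Lp W -> Lp Z -> 0 <= C ->
  (forall w, `|W w| <= C * `|Z w|) -> lp W <= C * lp Z.
Proof.
move=> [mW Woo] LZ C0 WZ; rewrite -lee_fin EFinM -!LpnormE//; last by case: LZ.
exact: Lpnorm_le.
Qed.

Lemma lpB Z W : Lp Z -> Lp W -> lp (fun w => Z w - W w) <= lp Z + lp W.
Proof.
move=> LZ LW.
have LN : Lp (fun w => - W w).
  by apply: Lpspace_opp => //; exact: sigma_algebra_measurable.
apply: le_trans (lpD LZ LN) _; rewrite lerD2l -[leRHS]mul1r.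
by apply: lp_le => // w; rewrite normrN mul1r.
Qed.

End LpSpaces.

(** * A Gronwall inequality with a weakly singular kernel *)

Section SingularGronwall.
Variable R : realType.
Implicit Types (x y k T : R) (n : nat).

(** With r = root4 x, the powers of x with exponents -1/2 and -3/4 are r^-2 and
    r^-3, so that all estimates on the kernel become polynomial. *)
Definition root4 x : R := Num.sqrt (Num.sqrt x).

Lemma root4_ge0 x : 0 <= root4 x. Proof. exact: sqrtr_ge0. Qed.

Lemma root4_gt0 x : 0 < x -> 0 < root4 x.
Proof. by move=> x0; rewrite /root4 !sqrtr_gt0. Qed.

Lemma root4X x : 0 <= x -> root4 x ^+ 4 = x.
Proof.
by move=> x0; rewrite (exprM _ 2 2) !sqr_sqrtr// sqrtr_ge0.
Qed.

Lemma le_root4 x y : x <= y -> root4 x <= root4 y.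
Proof. by move=> xy; rewrite /root4 !ler_wsqrtr. Qed.

Lemma powRN12 x : 0 < x -> x `^ (- (1 / 2)) = (root4 x ^+ 2)^-1.
Proof.
move=> x0; rewrite powRN mul1r powR12_sqrt ?ltW//.
by rewrite /root4 sqr_sqrtr// sqrtr_ge0.
Qed.

Lemma sum_nat_subn (f : nat -> R) n :
  \sum_(0 <= i < n) f (n - i)%N = \sum_(0 <= i < n) f i.+1.
Proof.
rewrite big_nat_rev /=; apply: eq_big_nat => i /andP[_ in_].
by rewrite add0n subKn.
Qed.

(** The Riemann sum of x^(-3/4) is dominated by its primitive 4 x^(1/4),
    telescoped along the grid: u^4 - v^4 = k for consecutive fourth roots
    v <= u, and u^4 - v^4 <= 4 (u - v) u^3. *)
Lemma sum_root4_cube_le k n : 0 < k ->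
  k * \sum_(0 <= i < n) (root4 (grid k (n - i)) ^+ 3)^-1 <= 4 * root4 (grid k n).
Proof.
move=> k0; rewrite (sum_nat_subn (fun i => (root4 (grid k i) ^+ 3)^-1)).
elim: n => [|n IHn].
  by rewrite big_geq// mulr0 mulr_ge0// root4_ge0.
rewrite big_nat_recr//= mulrDr.
apply: (@le_trans _ _ (4 * root4 (grid k n) +
  4 * (root4 (grid k n.+1) - root4 (grid k n)))); last by rewrite -mulrDr addrC subrK.
apply: lerD => //.
have u0 : 0 < root4 (grid k n.+1) by rewrite root4_gt0// /grid mulr_gt0.
have v0 := root4_ge0 (grid k n).
have vu : root4 (grid k n) <= root4 (grid k n.+1).
  by apply: le_root4; rewrite /grid ler_wpM2r ?ler_nat// ltW.
have : root4 (grid k n.+1) ^+ 4 - root4 (grid k n) ^+ 4 = k.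
  rewrite !root4X /grid ?mulr_ge0// ?(ltW k0)//.
  by rewrite -natr1 mulrDl mul1r addrAC subrr add0r.
move: u0 v0 vu; set u := root4 _; set v := root4 _ => u0 v0 vu <-.
rewrite -/(_ / _) ler_pdivrMr ?exprn_gt0//.
have -> : u ^+ 4 - v ^+ 4 = (u - v) * (u ^+ 3 + u ^+ 2 * v + u * v ^+ 2 + v ^+ 3).
  by ring.
have -> : 4 * (u - v) * u ^+ 3 = (u - v) * (4 * u ^+ 3) by ring.
rewrite ler_wpM2l ?subr_ge0//.
have h1 : u ^+ 2 * v <= u ^+ 3 by rewrite [u ^+ 3]exprSr ler_wpM2l// exprn_ge0// ltW.
have h2 : u * v ^+ 2 <= u ^+ 3.
  by rewrite [u ^+ 3]exprS ler_wpM2l ?(ltW u0)// lerXn2r// nnegrE ltW.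
have h3 : v ^+ 3 <= u ^+ 3 by rewrite lerXn2r// nnegrE ltW.
lra.
Qed.

Lemma ler_expRX4 y : 0 <= y -> y <= expR (y ^+ 4).
Proof.
move=> y0; apply: le_trans (expR_ge1Dx _).
have [y1|/ltW y1] := leP y 1; first by rewrite (le_trans y1)// lerDl exprn_ge0.
by rewrite -[leLHS]add0r lerD// ler_eXnr.
Qed.

(** On ]0, T] the kernel x^(-1/2) is at most T^(1/4) x^(-3/4), whose sums are
    already known. *)
Lemma singular_kernel_sum_le T k n : 0 < k -> grid k n <= T ->
  k * \sum_(1 <= j < n.+1) (grid k n - grid k j.-1) `^ (- (1 / 2)) <=
  4 * root4 T ^+ 2.
Proof.
move=> k0 nT.
have -> : 4 * root4 T ^+ 2 = root4 T * (4 * root4 T) by rewrite expr2 mulrCA.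
apply: (@le_trans _ _ (root4 T * (k *
    \sum_(0 <= i < n) (root4 (grid k (n - i)) ^+ 3)^-1))); last first.
  apply: ler_wpM2l; first exact: root4_ge0.
  by apply: le_trans (sum_root4_cube_le _ k0) _; rewrite ler_wpM2l// le_root4.
rewrite big_add1 /= mulrCA ler_wpM2l ?(ltW k0)// mulr_sumr.
rewrite big_nat_cond [leRHS]big_nat_cond; apply: ler_sum => i.
rewrite andbT => /andP[_ ilt].
have -> : grid k n - grid k i = grid k (n - i) by rewrite /grid natrB ?mulrBl// ltnW.
have g0 : 0 < grid k (n - i) by rewrite /grid mulr_gt0// ltr0n subn_gt0.
have r0 := root4_gt0 g0.
rewrite powRN12//.
have -> : (root4 (grid k (n - i)) ^+ 2)^-1 =
    root4 (grid k (n - i)) * (root4 (grid k (n - i)) ^+ 3)^-1.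
  by field; rewrite gt_eqF.
apply: ler_wpM2r; first by rewrite invr_ge0 exprn_ge0// ltW.
rewrite le_root4// (le_trans _ nT)// /grid ler_wpM2r ?(ltW k0)//.
by rewrite ler_nat leq_subr.
Qed.

(** Uniformity in k comes from an exponential weight.  One shows by strong
    induction that a_n <= 2 A exp(lambda t_n) for a lambda making the weighted
    kernel sum at most 1/2; such a lambda exists independently of k because
    exp(- lambda x) x^(-1/2) <= lambda^(-1/4) x^(-3/4), where the right-hand
    side has bounded sums.  Here lambda = l^4. *)
Lemma singular_gronwall (K : R) T : 0 <= K -> 0 < T ->
  exists2 C : R, 0 <= C & forall k N (a : nat -> R) (A : R),
    0 < k -> grid k N <= T -> 0 <= A ->
    (forall n, (n <= N)%N -> a n <= A + K * (k *
       \sum_(1 <= j < n.+1) (grid k n - grid k j.-1) `^ (- (1 / 2)) * a j.-1)) ->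
    forall n, (n <= N)%N -> a n <= C * A.
Proof.
(* With this l the weighted kernel sum is then at most
   4 K root4 T / l = K / (2 (K + 1)). *)
move=> K0 T0; have [l lE] : exists l, l = 8 * (K + 1) * root4 T by eexists.
have rT0 := root4_gt0 T0; have K1 : 0 < K + 1 by lra.
have l0 : 0 < l by rewrite lE mulr_gt0// mulr_gt0//; lra.
exists (2 * expR (l ^+ 4 * T)); first by rewrite mulr_ge0// expR_ge0.
move=> k N a A k0 NT A0 aP.
have gridle n : (n <= N)%N -> grid k n <= T.
  by move=> nN; rewrite (le_trans _ NT)// /grid ler_wpM2r ?(ltW k0)// ler_nat.
pose E n := expR (l ^+ 4 * grid k n).
suff aE n : (n <= N)%N -> a n <= 2 * E n * A.
  move=> n nN; apply: le_trans (aE n nN) _.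
  rewrite ler_wpM2r// ler_wpM2l// ler_expR ler_wpM2l ?exprn_ge0 ?(ltW l0)//.
  exact: gridle.
elim/ltn_ind: n => n IHn nN; apply: le_trans (aP n nN) _.
have E1 : 1 <= E n.
  by rewrite -expR0 ler_expR mulr_ge0 ?exprn_ge0 ?(ltW l0)// /grid mulr_ge0// ltW.
suff h : K * (k * \sum_(1 <= j < n.+1)
    (grid k n - grid k j.-1) `^ (- (1 / 2)) * a j.-1) <= E n * A.
  have : A <= E n * A by rewrite ler_peMl.
  lra.
apply: (@le_trans _ _ (K * (2 * E n * A / l * (k *
    \sum_(0 <= i < n) (root4 (grid k (n - i)) ^+ 3)^-1)))).
  apply: ler_wpM2l => //; rewrite mulrCA; apply: ler_wpM2l; first exact: ltW.
  rewrite big_add1 /= mulr_sumr big_nat_cond [leRHS]big_nat_cond.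
  apply: ler_sum => i; rewrite andbT => /andP[_ ilt].
  have dE : grid k n - grid k i = grid k (n - i).
    by rewrite /grid natrB ?mulrBl// ltnW.
  have g0 : 0 < grid k (n - i) by rewrite /grid mulr_gt0// ltr0n subn_gt0.
  have r0 := root4_gt0 g0.
  rewrite dE powRN12//.
  have -> : 2 * E n * A / l * (root4 (grid k (n - i)) ^+ 3)^-1 =
      (root4 (grid k (n - i)) ^+ 2)^-1 *
      (2 * E n * A * (l * root4 (grid k (n - i)))^-1).
    by field; rewrite !gt_eqF.
  apply: ler_wpM2l; first by rewrite invr_ge0 exprn_ge0// ltW.
  apply: le_trans (IHn i ilt (leq_trans (ltnW ilt) nN)) _.
  (* E i is E n times the weight exp (- l^4 (t_n - t_i)). *)
  have -> : E i = E n * expR (- (l ^+ 4 * grid k (n - i))).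
    by rewrite /E -expRD -dE; congr expR; ring.
  have -> : forall e, 2 * (E n * e) * A = 2 * E n * A * e by move=> e; ring.
  apply: ler_wpM2l; first by rewrite mulr_ge0// mulr_ge0// expR_ge0.
  rewrite expRN lef_pV2 ?posrE ?expR_gt0 ?mulr_gt0//.
  have -> : l ^+ 4 * grid k (n - i) = (l * root4 (grid k (n - i))) ^+ 4.
    by rewrite [RHS]exprMn root4X ?(ltW g0).
  by apply: ler_expRX4; rewrite mulr_ge0// ltW.
apply: (@le_trans _ _ (K * (2 * E n * A / l * (4 * root4 T)))).
  apply: ler_wpM2l => //; apply: ler_wpM2l.
    by rewrite divr_ge0 ?(ltW l0)// mulr_ge0// mulr_ge0// expR_ge0.
  apply: le_trans (sum_root4_cube_le _ k0) _.
  by rewrite ler_wpM2l// le_root4// gridle.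
have -> : K * (2 * E n * A / l * (4 * root4 T)) = K / (K + 1) * (E n * A).
  by rewrite lE; field; rewrite !gt_eqF.
rewrite ler_piMl//; first by rewrite mulr_ge0// expR_ge0.
by rewrite ler_pdivrMr; lra.
Qed.

End SingularGronwall.

(** * Iterates of a bounded linear operator *)

Section OperatorNorm.
Context (R : realType) (H : normedModType R).
Implicit Types (f : {linear H -> H}) (C : R) (n : nat).

Lemma opnorm_ge0 (f : H -> H) : (0 <= opnorm f)%E.
Proof.
apply: (@le_trans _ _ `|f 0|%:E); first by rewrite lee_fin.
by apply: ereal_sup_ubound; exists 0 => //=; rewrite normr0.
Qed.

Lemma opnorm_le (f : H -> H) C x : (forall a y, f (a *: y) = a *: f y) ->
  (opnorm f <= C%:E)%E -> `|f x| <= C * `|x|.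
Proof.
move=> fZ fC; have [->|x0] := eqVneq x 0.
  by rewrite -[0](scale0r 0) fZ !scale0r normr0 mulr0.
have nx : 0 < `|x| by rewrite normr_gt0.
have : (`|f (`|x|^-1 *: x)|%:E <= C%:E)%E.
  apply: le_trans fC; apply: ereal_sup_ubound; exists (`|x|^-1 *: x) => //=.
  by rewrite normrZ gtr0_norm ?invr_gt0// mulVf ?gt_eqF.
by rewrite lee_fin fZ normrZ gtr0_norm ?invr_gt0// mulrC ler_pdivrMr.
Qed.

Lemma iter_linearZ f n a x : iter n f (a *: x) = a *: iter n f x.
Proof. by elim: n => //= n ->; rewrite linearZ. Qed.

Lemma iter_linear0 f n : iter n f 0 = 0.
Proof. by elim: n => //= n ->; rewrite linear0. Qed.

Lemma opnorm_continuous f : (opnorm f < +oo)%E -> continuous f.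
Proof.
move=> foo; have fC : (opnorm f <= (fine (opnorm f))%:E)%E.
  by rewrite fineK// ge0_fin_numE// opnorm_ge0.
apply/bounded_linear_continuous/bounded_funP => r.
exists (fine (opnorm f) * r) => x xr.
have fZ a y : f (a *: y) = a *: f y by rewrite linearZ.
apply: le_trans (opnorm_le x fZ fC) _.
by rewrite ler_wpM2l// fine_ge0// opnorm_ge0.
Qed.

Lemma iter_continuous (f : H -> H) n : continuous f -> continuous (iter n f).
Proof.
move=> cf; elim: n => [|n IHn] x; first exact: cvg_id.
by apply: continuous_comp; [exact: IHn|exact: cf].
Qed.

(** The discrete convolution with the powers of f is the solution of the linear
    recursion v_(n+1) = f v_n + u_(n+1) with v_0 = 0. *)
Lemma convolution_recr f (u : nat -> H) n :
  \sum_(1 <= j < n.+2) iter (n.+1 - j) f (u j) =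
  f (\sum_(1 <= j < n.+1) iter (n - j) f (u j)) + u n.+1.
Proof.
rewrite big_nat_recr//= subnn/= linear_sum; congr (_ + _).
by apply: eq_big_nat => j /andP[_ jn]; rewrite subSn.
Qed.

End OperatorNorm.

(** * The residual operator of the one-step scheme *)

Section OneStepScheme.
Context (R : realType) (T : R) (H : completeNormedModType R).
Context (d : measure_display) (Omega : measurableType d).
Context (P : probability Omega R) (F : R -> set_system Omega) (N : R -> nat).
Context (p : R) (xi : Omega -> H) (S : R -> {linear H -> H}).
Context (Phi : H -> R -> R -> Omega -> H) (C_Phi C_S : R).
Hypothesis H_sep : separable H.
Hypothesis F_normal : normal_filtration P T F.
Hypothesis N_spec : forall k : R, 0 < k <= T -> (N k)%:R * k <= T.
Hypothesis p_ge1 : 1 <= p.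
Hypothesis xi_init : initial_value P p F xi.
Hypothesis S_bounded : forall k : R, 0 < k <= T -> (opnorm (S k) < +oo)%E.
Hypothesis C_S_ge1 : 1 <= C_S.
Hypothesis S_stable : forall k : R, 0 < k <= T ->
  forall n, (n <= N k)%N -> forall x, `|iter n (S k) x| <= C_S * `|x|.
Hypothesis Phi_meas : Phi_measurable T F Phi.
Hypothesis Phi_at_zero : Phi_at_zero_bound P T p N S Phi C_Phi.
Hypothesis Phi_lip : Phi_lipschitz_bound P T p F N S Phi C_Phi.

Variable k : R.
Hypothesis kT : 0 < k <= T.

Local Notation Lp := (@Lpspace R d Omega P H p).
Local Notation Gpk := (@Gp R d Omega P H p F N k).
Local Notation t := (grid k).

Let k_gt0 : 0 < k. Proof. by case/andP: kT. Qed.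

Lemma gridS n : t n.+1 = t n + k.
Proof. by rewrite /grid -natr1 mulrDl mul1r. Qed.

Lemma le_grid m n : (m <= n)%N -> t m <= t n.
Proof. by move=> mn; rewrite /grid ler_wpM2r ?ler_nat// ltW. Qed.

Lemma grid_ge0 n : 0 <= t n.
Proof. by rewrite /grid mulr_ge0// ltW. Qed.

Lemma grid_leT n : (n <= N k)%N -> t n <= T.
Proof. by move=> nN; apply: le_trans (le_grid nN) (N_spec kT). Qed.

Lemma grid_sigma_algebra n : (n <= N k)%N -> sigma_algebra setT (F (t n)).
Proof.
by move=> nN; apply: (filtration_sigma_algebra F_normal); rewrite grid_ge0 grid_leT.
Qed.

Lemma grid_sub n : (n <= N k)%N -> F (t n) `<=` measurable.
Proof.
by move=> nN; apply: (filtration_sub F_normal); rewrite grid_ge0 grid_leT.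
Qed.

Lemma grid_mono m n : (m <= n)%N -> (n <= N k)%N -> F (t m) `<=` F (t n).
Proof.
move=> mn nN; apply: (filtration_mono F_normal) (grid_leT nN).
- exact: grid_ge0.
- exact: le_grid.
Qed.

Let S_cont : continuous (S k).
Proof. exact/opnorm_continuous/S_bounded. Qed.

Let C_S_ge0 : 0 <= C_S. Proof. exact: le_trans C_S_ge1. Qed.

Lemma Lpspace_iter G n (Z : Omega -> H) :
  sigma_algebra setT G -> G `<=` measurable -> (n <= N k)%N ->
  Lp G Z -> Lp G (fun w => iter n (S k) (Z w)).
Proof.
move=> sG Gm nN; apply: (@Lpspace_lipschitz _ _ _ _ _ _ p_ge1 _ sG Gm _ C_S) => //.
- exact: iter_continuous.
- exact: S_stable.
Qed.

Lemma Gp_measurable n Z : (n <= N k)%N -> Gpk Z -> Lp measurable (Z n).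
Proof. by move=> nN /(_ _ nN); apply: sub_Lpspace; exact: grid_sub. Qed.

Lemma Gp_subprocess n Y Z : (n <= N k)%N -> Gpk Y -> Gpk Z ->
  Lp measurable (subprocess Y Z n).
Proof.
move=> nN GY GZ; apply: Lpspace_sub => //; first exact: sigma_algebra_measurable.
- exact: Gp_measurable.
- exact: Gp_measurable.
Qed.

Local Notation dPhi Y Z w := (fun j : nat =>
  Phi (Y j.-1 w) (t j.-1) k w - Phi (Z j.-1 w) (t j.-1) k w).
Local Notation conv n u := (\sum_(1 <= j < n.+1) iter (n - j) (S k) (u j)).

(** The Lipschitz hypothesis in terms of real numbers; the finiteness of its
    right-hand side also yields that the convolved increments have a finite
    norm, before they are known to lie in L_p one by one. *)
Lemma lp_Phi_lipschitz n Y Z : (1 <= n <= N k)%N -> Gpk Y -> Gpk Z ->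
  (Lpnorm P p (fun w => conv n (dPhi Y Z w)) < +oo)%E /\
  lp P p (fun w => conv n (dPhi Y Z w)) ^+ 2 <=
  C_Phi ^+ 2 * (k * \sum_(1 <= j < n.+1)
     (t n - t j.-1) `^ (- (1 / 2)) * lp P p (subprocess Y Z j.-1) ^+ 2).
Proof.
move=> nN GY GZ; have := Phi_lip kT nN GY GZ.
under eq_big_nat => j /andP[j1 jn].
  rewrite LpnormE; last first.
    have jN : (j.-1 <= N k)%N.
      by case/andP: nN => _; apply: leq_trans; apply: leq_trans (leq_pred j) jn.
    by have [] := Gp_subprocess jN GY GZ.
  rewrite -EFin_expe -EFinM.
over.
rewrite sumEFin -EFinM -mulrA; set rhs := (X in X%:E) => h.
have fin : (Lpnorm P p (fun w => conv n (dPhi Y Z w)) < +oo)%E.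
  rewrite ltey; apply/eqP => oo; move: h; rewrite oo expe2 mulyy leye_eq.
  by [].
by split => //; move: h; rewrite LpnormE// -EFin_expe lee_fin.
Qed.

Lemma Phi_measurable_comp m (Z : Omega -> H) : (m < N k)%N ->
  measurable_wrt (F (t m)) (@borel H) Z ->
  measurable_wrt (F (t m.+1)) (@borel H) (fun w => Phi (Z w) (t m) k w).
Proof.
move=> mN mZ B BB.
have tk : t m + k <= T by rewrite -gridS grid_leT.
have tT : 0 <= t m < T.
  by rewrite grid_ge0/= (lt_le_trans _ tk)// ltrDl.
have := measurable_wrt_pair (grid_sigma_algebra mN)
  (measurable_wrtS (grid_mono (leqnSn m) mN) mZ)
  ((fun B FB => FB) : measurable_wrt (F (t m.+1)) (F (t m.+1)) id).
rewrite gridS => mp; have := Phi_meas tT kT tk BB.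
by move=> /mp; rewrite -gridS.
Qed.

(** Phi(Z) = (Phi(Z) - Phi(0)) + Phi(0).  The second summand is the case m = n
    of the bound at zero.  The first is the last term of the convolution in
    the Lipschitz hypothesis for a process equal to Z at t_m and zero at the
    other grid points, compared with the zero process: all other terms
    vanish. *)
Lemma Phi_Lpspace m (Z : Omega -> H) : (m < N k)%N -> Lp (F (t m)) Z ->
  Lp (F (t m.+1)) (fun w => Phi (Z w) (t m) k w).
Proof.
move=> mN LZ; have mN' := ltnW mN; have sG := grid_sigma_algebra mN.
have Gm := grid_sub mN.
have L0 n : (n <= N k)%N -> Lp (F (t n)) (fun=> 0).
  by move=> nN; apply: Lpspace0 => //; exact: grid_sigma_algebra.
have mPhi0 := Phi_measurable_comp mN (L0 _ mN').1.
have LPhi0 : Lp (F (t m.+1)) (fun w => Phi 0 (t m) k w).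
  split => //; have := Phi_at_zero kT (ltn0Sn m) (leqnn _) mN.
  under eq_fun do rewrite big_nat1 subnn /=.
  by move=> /le_lt_trans; apply; rewrite ltry.
have LD : Lp (F (t m.+1)) (fun w => Phi (Z w) (t m) k w - Phi 0 (t m) k w).
  split.
    apply: measurable_wrtD => //; first exact: Phi_measurable_comp LZ.1.
    by apply: (measurable_wrt_continuous sG _ mPhi0); exact: opp_continuous.
  pose Y n := if n == m then Z else (fun=> 0).
  have GY : Gpk Y.
    by move=> n nN; rewrite /Y; case: eqP => [->|_]; [exact: LZ|exact: L0].
  have G0 : Gpk (fun _ _ => 0) by move=> n; exact: L0.
  have [] := @lp_Phi_lipschitz m.+1 Y _ mN GY G0.
  rewrite (_ : (fun w => _) = fun w => Phi (Z w) (t m) k w - Phi 0 (t m) k w)//.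
  apply/funext => w; rewrite big_nat_recr//= subnn /= /Y eqxx.
  rewrite big_nat_cond big1 ?add0r// => j; rewrite andbT => /andP[j1 jm].
  by rewrite lt_eqF ?subrr ?iter_linear0//; case: j j1 jm.
have := Lpspace_add H_sep p_ge1 sG Gm LD LPhi0.
by under eq_fun do rewrite subrK.
Qed.

Lemma scheme_step_Lpspace m (Z : Omega -> H) : (m < N k)%N ->
  Lp (F (t m)) Z ->
  Lp (F (t m.+1)) (fun w => S k (Z w) + Phi (Z w) (t m) k w).
Proof.
move=> mN LZ; have sG := grid_sigma_algebra mN; have Gm := grid_sub mN.
apply: Lpspace_add => //; last exact: Phi_Lpspace.
apply: (@Lpspace_iter _ 1) => //; first exact: leq_ltn_trans mN.
by apply: sub_Lpspace LZ; exact: grid_mono.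
Qed.

Lemma residual_Gp Z : Gpk Z -> Gpk (residual xi S Phi k Z).
Proof.
move=> GZ [|m] mN.
  apply: Lpspace_sub => //; [exact: grid_sigma_algebra|exact: grid_sub|exact: GZ|].
  by rewrite /grid mul0r.
have := Lpspace_sub H_sep p_ge1 (grid_sigma_algebra mN) (grid_sub mN)
  (GZ _ mN) (scheme_step_Lpspace mN (GZ _ (ltnW mN))).
by under eq_fun do rewrite opprD addrA.
Qed.

Lemma residual_well_definedP : residual_well_defined P p F N xi S Phi k.
Proof.
split; first exact: residual_Gp.
move=> Y Z _ _ YZ [|m] mN /=.
  by have := YZ _ mN; apply: filterS => w h /h ->.
apply: filterS2 (YZ _ mN) (YZ _ (ltnW mN)) => w h1 h2 /[dup] /h1 -> /h2 ->.
by [].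
Qed.

Fixpoint residual_preimage (V : nat -> Omega -> H) n w : H :=
  if n is m.+1 then
    V m.+1 w + (S k (residual_preimage V m w) +
      Phi (residual_preimage V m w) (t m) k w)
  else V 0%N w + xi w.

Lemma residual_preimage_Gp V : Gpk V -> Gpk (residual_preimage V).
Proof.
move=> GV; elim=> [|m IHm] mN.
  apply: Lpspace_add => //; [exact: grid_sigma_algebra|exact: grid_sub|exact: GV|].
  by rewrite /grid mul0r.
apply: Lpspace_add => //; [exact: grid_sigma_algebra|exact: grid_sub|exact: GV|].
by apply: scheme_step_Lpspace => //; apply: IHm; exact: ltnW.
Qed.

Lemma residual_preimageK V n w :
  residual xi S Phi k (residual_preimage V) n w = V n w.
Proof. by case: n => [|n] /=; rewrite ?addrK// -addrA -opprD addrK. Qed.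

Lemma residual_bijectiveP : residual_bijective P p F N xi S Phi k.
Proof.
split=> [Y Z _ _ RYZ|V GV].
  elim=> [|m IHm] mN.
    by apply: filterS (RYZ _ mN) => w /= h /h /addIr.
  apply: filterS2 (RYZ _ mN) (IHm (ltnW mN)) => w /= h1 h2.
  by move=> wT; move: (h1 wT); rewrite (h2 wT) => /addIr/addIr.
exists (residual_preimage V); first exact: residual_preimage_Gp.
by move=> n _; apply/nearW => w _; exact: residual_preimageK.
Qed.

(** * Two-sided stability bounds *)

Section Stability.
Variables Y Z : gridprocess Omega H.
Hypotheses (GY : Gpk Y) (GZ : Gpk Z).

Local Notation RYZ :=
  (subprocess (residual xi S Phi k Y) (residual xi S Phi k Z)).
Local Notation e n := (lp P p (subprocess Y Z n)).
Local Notation q n := (lp P p (fun w => conv n (fun j => RYZ j w))).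
Local Notation L n := (lp P p (fun w => conv n (dPhi Y Z w))).

(** Discrete variation of constants: convolving the residual with the powers of
    S_k telescopes the linear part of the scheme. *)
Lemma residual_conv n w :
  conv n (fun j => RYZ j w) = subprocess Y Z n w -
    (iter n (S k) (subprocess Y Z 0%N w) + conv n (dPhi Y Z w)).
Proof.
elim: n => [|n IHn]; first by rewrite !big_geq// addr0 subrr.
have subrACA (a b a' b' : H) : (a - b) - (a' - b') = (a - a') - (b - b').
  by rewrite opprD addrACA -opprD.
rewrite (convolution_recr _ (fun j => RYZ j w)) IHn.
rewrite (convolution_recr _ (dPhi Y Z w)) linearB [X in _ - X + _]linearD /=.
rewrite [RYZ n.+1 w]/subprocess /= subrACA (subrACA (Y n.+1 w)) -linearB.
have cancel (a b c x : H) : a - b + (c - a - x) = c - (b + x).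
  by rewrite -[in RHS](subrK a c) opprD addrACA [a + _]addrC.
by rewrite cancel [in RHS]addrA.
Qed.

Lemma residual0 : lp P p (RYZ 0%N) = e 0%N.
Proof.
congr (lp P p _); apply/funext => w.
by rewrite /subprocess /= opprB addrA subrK.
Qed.

Lemma Lpspace_conv_Phi n : (n <= N k)%N ->
  Lp measurable (fun w => conv n (dPhi Y Z w)).
Proof.
move=> nN; have sM := @sigma_algebra_measurable _ Omega.
apply: Lpspace_sum => // j; rewrite mem_index_iota => /andP[j1 jn].
have jN : (j.-1 < N k)%N.
  by rewrite prednK ?(leq_trans _ nN).
apply: Lpspace_iter => //; first by rewrite (leq_trans (leq_subr _ _)).
have LPhi X : Gpk X -> Lp measurable (fun w => Phi (X j.-1 w) (t j.-1) k w).
  move=> GX; apply: (sub_Lpspace (grid_sub jN)).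
  by apply: Phi_Lpspace => //; apply: GX; exact: ltnW.
by apply: Lpspace_sub => //; exact: LPhi.
Qed.

Lemma Lpspace_iter0 n : (n <= N k)%N ->
  Lp measurable (fun w => iter n (S k) (subprocess Y Z 0%N w)).
Proof.
move=> nN; apply: Lpspace_iter => //; first exact: sigma_algebra_measurable.
exact: Gp_subprocess.
Qed.

Lemma lp_remainder n : (n <= N k)%N ->
  Lp measurable (fun w => iter n (S k) (subprocess Y Z 0%N w) + conv n (dPhi Y Z w)) /\
  lp P p (fun w => iter n (S k) (subprocess Y Z 0%N w) + conv n (dPhi Y Z w)) <=
  C_S * e 0%N + L n.
Proof.
move=> nN; have LA := Lpspace_iter0 nN; have LB := Lpspace_conv_Phi nN.
split; first exact: (Lpspace_add H_sep p_ge1 (@sigma_algebra_measurable _ _)).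
apply: le_trans (lpD H_sep p_ge1 LA LB) _; rewrite lerD2r.
apply: lp_le => //; first exact: Gp_subprocess.
by move=> w; exact: S_stable.
Qed.

Lemma lp_residual_conv_le n : (n <= N k)%N ->
  (Lpnorm P p (fun w => conv n (fun j => RYZ j w)) < +oo)%E /\
  q n <= e n + (C_S * e 0%N + L n).
Proof.
move=> nN; have [LR hR] := lp_remainder nN; have LD := Gp_subprocess nN GY GZ.
rewrite (_ : (fun w => conv n (fun j => RYZ j w)) = fun w =>
    subprocess Y Z n w -
    (iter n (S k) (subprocess Y Z 0%N w) + conv n (dPhi Y Z w))); last first.
  by apply/funext => w; exact: residual_conv.
split; last by apply: le_trans (lpB H_sep p_ge1 LD LR) _; rewrite lerD2l.
by have [] := Lpspace_sub H_sep p_ge1 (@sigma_algebra_measurable _ _) (fun _ h => h) LD LR.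
Qed.

Lemma lp_error_le n : (n <= N k)%N -> e n <= q n + (C_S * e 0%N + L n).
Proof.
move=> nN; have [LR hR] := lp_remainder nN; have LD := Gp_subprocess nN GY GZ.
rewrite {1}(_ : subprocess Y Z n = fun w => conv n (fun j => RYZ j w) +
    (iter n (S k) (subprocess Y Z 0%N w) + conv n (dPhi Y Z w))); last first.
  by apply/funext => w; rewrite residual_conv subrK.
apply: le_trans (lpD H_sep p_ge1 _ LR) _; last by rewrite lerD2l.
under eq_fun do rewrite residual_conv.
exact: (Lpspace_sub H_sep p_ge1 (@sigma_algebra_measurable _ _) (fun _ h => h)).
Qed.

(** Bounding every error by E in the Lipschitz estimate leaves k times the sum
    of the kernel, at most 4 sqrt T; its square root 2 T^(1/4) is the factor of
    |C_Phi|. *)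
Lemma residual_conv_bound (E : R) : (forall n, (n <= N k)%N -> e n <= E) ->
  forall n, (1 <= n <= N k)%N ->
  q n <= (1 + C_S + 2 * `|C_Phi| * root4 T) * E.
Proof.
move=> eE n /andP[n1 nN]; apply: le_trans (lp_residual_conv_le nN).2 _.
have E0 : 0 <= E by apply: le_trans (eE 0%N _) => //; exact: lp_ge0.
have : C_S * e 0%N <= C_S * E by rewrite ler_wpM2l// eE.
have := eE _ nN.
suff : L n <= 2 * `|C_Phi| * root4 T * E by lra.
have r0 := root4_ge0 T.
rewrite -ler_sqr ?nnegrE ?lp_ge0 ?mulr_ge0//.
have n1N : (1 <= n <= N k)%N by rewrite n1.
have [_ hL] := lp_Phi_lipschitz n1N GY GZ; apply: le_trans hL _.
have -> : (2 * `|C_Phi| * root4 T * E) ^+ 2 =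
    C_Phi ^+ 2 * (4 * root4 T ^+ 2 * E ^+ 2).
  by rewrite -[C_Phi ^+ 2]real_normK ?num_real//; ring.
rewrite ler_wpM2l ?sqr_ge0//.
apply: (@le_trans _ _ (k * \sum_(1 <= j < n.+1)
    (t n - t j.-1) `^ (- (1 / 2)) * E ^+ 2)); last first.
  rewrite -mulr_suml mulrA ler_wpM2r ?sqr_ge0//.
  by apply: singular_kernel_sum_le => //; exact: grid_leT.
rewrite ler_wpM2l ?(ltW k_gt0)// big_nat_cond [leRHS]big_nat_cond.
apply: ler_sum => j; rewrite andbT => /andP[_ jn].
rewrite ler_wpM2l ?powR_ge0// lerXn2r ?nnegrE ?lp_ge0//.
by apply: eE; rewrite (leq_trans (leq_pred j))// (leq_trans _ nN).
Qed.

(** Squaring turns the Lipschitz estimate into a linear inequality for the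
    squared errors, to which Gronwall applies; the two summands of the square
    cost a factor 2.  The Gronwall inequality is a hypothesis so that its
    constant G is fixed before k. *)
Lemma error_bound (G rho : R) :
  (forall (a : nat -> R) (A : R), 0 <= A ->
    (forall n, (n <= N k)%N -> a n <= A + 2 * C_Phi ^+ 2 * (k *
       \sum_(1 <= j < n.+1) (t n - t j.-1) `^ (- (1 / 2)) * a j.-1)) ->
    forall n, (n <= N k)%N -> a n <= G * A) ->
  0 <= G -> e 0%N <= rho -> (forall n, (1 <= n <= N k)%N -> q n <= rho) ->
  forall n, (n <= N k)%N -> e n <= Num.sqrt (2 * G) * (1 + C_S) * rho.
Proof.
move=> gronwall G0 e0 qrho n nN.
have rho0 : 0 <= rho by apply: le_trans e0; exact: lp_ge0.
have B0 : 0 <= (1 + C_S) * rho by rewrite mulr_ge0// addr_ge0.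
rewrite -ler_sqr ?nnegrE ?lp_ge0//; last by rewrite -mulrA mulr_ge0// sqrtr_ge0.
rewrite -mulrA exprMn sqr_sqrtr ?mulr_ge0//.
have -> : 2 * G * ((1 + C_S) * rho) ^+ 2 = G * (2 * ((1 + C_S) * rho) ^+ 2) by ring.
apply: (gronwall (fun n => e n ^+ 2)) nN.
  by rewrite mulr_ge0// sqr_ge0.
move=> {}n nN; have [->|n0] := posnP n.
  rewrite big_geq// mulr0 mulr0 addr0.
  have : e 0%N ^+ 2 <= ((1 + C_S) * rho) ^+ 2.
    rewrite lerXn2r ?nnegrE ?lp_ge0// (le_trans e0)// ler_peMl//.
    by rewrite lerDl.
  have := sqr_ge0 ((1 + C_S) * rho); lra.
have n1N : (1 <= n <= N k)%N by rewrite n0.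
have [_ hL] := lp_Phi_lipschitz n1N GY GZ.
have h : e n <= (1 + C_S) * rho + L n.
  apply: le_trans (lp_error_le nN) _.
  have := qrho _ n1N; have : C_S * e 0%N <= C_S * rho by rewrite ler_wpM2l.
  lra.
have h2 : e n ^+ 2 <= ((1 + C_S) * rho + L n) ^+ 2.
  by rewrite lerXn2r ?nnegrE ?lp_ge0// addr_ge0// lp_ge0.
have h3 : ((1 + C_S) * rho + L n) ^+ 2 <= 2 * ((1 + C_S) * rho) ^+ 2 + 2 * L n ^+ 2.
  have := sqr_ge0 ((1 + C_S) * rho - L n).
  move: ((1 + C_S) * rho) (L n) => x y; rewrite !expr2; lra.
apply: le_trans h2 _; apply: le_trans h3 _; rewrite lerD2l -mulrA ler_wpM2l//.
Qed.

Lemma norm0E : norm0 P p N k (subprocess Y Z) =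
  (\big[Num.max/0]_(0 <= n < (N k).+1) e n)%:E.
Proof.
rewrite -EFin_bigmax; apply: eq_big_nat => n /andP[_ nN].
by rewrite LpnormE//; have [] := Gp_subprocess nN GY GZ.
Qed.

Lemma spijker_normE : spijker_norm P p N S k RYZ =
  (e 0%N + \big[Num.max/0]_(1 <= n < (N k).+1) q n)%:E.
Proof.
rewrite EFinD -EFin_bigmax; congr (_ + _)%E.
  rewrite LpnormE ?residual0//; rewrite (_ : RYZ 0%N = subprocess Y Z 0%N).
    by have [] := Gp_subprocess (leq0n _) GY GZ.
  by apply/funext => w; rewrite /subprocess /= opprB addrA subrK.
apply: eq_big_nat => n /andP[_ nN].
by rewrite LpnormE//; have [] := lp_residual_conv_le nN.
Qed.

End Stability.

End OneStepScheme.

(** * Bistability *)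

Theorem theorem3p8 (R : realType) (T : R) (T_gt0 : 0 < T)
  (H : completeNormedModType R) (H_hilbert : hilbert H) (H_sep : separable H)
  (d : measure_display) (Omega : measurableType d) (P : probability Omega R)
  (F : R -> set_system Omega) (F_normal : normal_filtration P T F)
  (N : R -> nat)
  (N_spec : forall k : R, 0 < k <= T ->
     (N k)%:R * k <= T /\ T < ((N k)%:R + 1) * k)
  (p : R) (p_ge2 : 2 <= p)
  (xi : Omega -> H) (S : R -> {linear H -> H})
  (Phi : H -> R -> R -> Omega -> H)
  (xi_init : initial_value P p F xi)
  (S_stable : linear_stability T N S)
  (Phi_stable : nonlinear_stability P T p F N S Phi) :
  (forall k : R, 0 < k <= T ->
     residual_well_defined P p F N xi S Phi k /\
     residual_bijective P p F N xi S Phi k) /\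
  bistable P T p F N xi S Phi.
Proof.
have p_ge1 : 1 <= p by rewrite (le_trans _ p_ge2)// ler1n.
have [S_bounded [C_S0 S_iter]] := S_stable.
have [Phi_meas [C_Phi [Phi_at_zero Phi_lip]]] := Phi_stable.
have N_le k : 0 < k <= T -> (N k)%:R * k <= T by move=> /N_spec[].
(* The hypothesis on the powers starts at n = 1; adding 1 covers n = 0. *)
pose C_S := 1 + `|C_S0|.
have C_S_ge1 : 1 <= C_S by rewrite lerDl.
have iter_le k : 0 < k <= T -> forall n, (n <= N k)%N ->
    forall x, `|iter n (S k) x| <= C_S * `|x|.
  move=> kT [|n] nN x; first by rewrite ler_peMl.
  apply: le_trans (opnorm_le x (iter_linearZ (S k) n.+1) (S_iter k kT n.+1 nN)) _.
  by rewrite ler_wpM2r// (le_trans (ler_norm _))// lerDr.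
split=> [k kT|].
  split.
    exact: (residual_well_definedP H_sep F_normal N_le p_ge1 xi_init S_bounded C_S_ge1
      iter_le Phi_meas Phi_at_zero Phi_lip kT).
  exact: (residual_bijectiveP H_sep F_normal N_le p_ge1 xi_init S_bounded C_S_ge1
    iter_le Phi_meas Phi_at_zero Phi_lip kT).
have K0 : 0 <= 2 * C_Phi ^+ 2 by rewrite mulr_ge0// sqr_ge0.
have [G G0 gronwall] := singular_gronwall K0 T_gt0.
pose M := 1 + C_S + 2 * `|C_Phi| * root4 T.
pose M' := Num.sqrt (2 * G) * (1 + C_S).
have M_ge0 : 0 <= M.
  have : 0 <= 2 * `|C_Phi| * root4 T by rewrite mulr_ge0// root4_ge0.
  by rewrite /M; lra.
have M'_ge0 : 0 <= M' by rewrite mulr_ge0 ?sqrtr_ge0//; lra.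
(* M bounds the convolved residuals, the extra 1 the initial term of the
   Spijker norm, and M' is the Gronwall constant of the converse. *)
exists (1 + M + M'); split=> [|k kT Y Z GY GZ]; first by lra.
move=> /=.
rewrite (norm0E H_sep F_normal N_le p_ge1 kT GY GZ).
rewrite (spijker_normE xi H_sep F_normal N_le p_ge1 S_bounded C_S_ge1
  iter_le Phi_meas Phi_at_zero Phi_lip kT GY GZ) -!EFinM !lee_fin.
set E := \big[_/_]_(0 <= _ < _) _; set q := \big[_/_]_(1 <= _ < _) _.
set e0 := lp _ _ _.
have eE n : (n <= N k)%N -> lp P p (subprocess Y Z n) <= E.
  move=> nN; rewrite /E.
  apply: (le_bigmax_seq 0 n xpredT (fun n => lp P p (subprocess Y Z n))) => //.
  by rewrite mem_index_iota.
have e0E : e0 <= E := eE 0%N (leq0n _).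
have e00 : 0 <= e0 by exact: lp_ge0.
have q0 : 0 <= q.
  by rewrite /q; elim/big_ind: _ => // *; rewrite ?le_max; [apply/orP; left|exact: lp_ge0].
pose qs n := lp P p (fun w => \sum_(1 <= j < n.+1) iter (n - j) (S k)
  (subprocess (residual xi S Phi k Y) (residual xi S Phi k Z) j w)).
have qle n : (1 <= n <= N k)%N -> qs n <= q.
  by move=> nN; rewrite /q; apply: (le_bigmax_seq 0 n xpredT qs) => //; rewrite mem_index_iota.
split.
  rewrite ler_pdivrMl; last by lra.
  have : q <= M * E.
    rewrite /q big_seq; elim/big_ind: _ => [|x y hx hy|n].
    - by rewrite mulr_ge0// (le_trans e00).
    - by rewrite ge_max hx.
    - rewrite mem_index_iota => nN.
      exact: (residual_conv_bound xi H_sep F_normal N_le p_ge1 S_bounded C_S_ge1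
        iter_le Phi_meas Phi_at_zero Phi_lip kT GY GZ eE nN).
  have : 0 <= M' * E by rewrite mulr_ge0// (le_trans e00).
  by lra.
apply: (@le_trans _ _ (M' * (e0 + q))); last first.
  by rewrite ler_wpM2r ?addr_ge0// lerDr addr_ge0.
rewrite /E big_seq; elim/big_ind: _ => [|x y hx hy|n].
- by rewrite mulr_ge0// addr_ge0.
- by rewrite ge_max hx.
- rewrite mem_index_iota => /= nN.
  apply: (error_bound H_sep F_normal N_le p_ge1 S_bounded C_S_ge1
    iter_le Phi_meas Phi_at_zero Phi_lip kT GY GZ) nN => //.
  + move=> a A A0; apply: gronwall A0; first by case/andP: kT.
    exact: N_le.
  + by rewrite lerDl.
  + by move=> m mN; apply: le_trans (qle _ mN) _; rewrite lerDr.
Qed.
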